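(* Let $R$ be an integral domain. A reduced sequence $\mathcal{A}$ of $2\times 2$ matrices over $R$ of length $\geq 4$ is triangularizable over $R$ if and only if all subsequences of $\mathcal{A}$ of length $\leq 2$ are triangularizable over $R$.
   Context: A matrix sequence $\mathcal{A}=(A_1,A_2,\dots)$ over the integral domain $R$ is a finite or countably infinite sequence of $2\times 2$ matrices with entries in $R$. The group $GL_2(R)$ acts by simultaneous conjugation, $g\cdot\mathcal{A}=(gA_1g^{-1},gA_2g^{-1},\dots)$. A sequence is triangularizable (over $R$) if for some $g\in GL_2(R)$ all terms of $g\cdot\mathcal{A}$ are upper triangular. A subsequence is obtained by deleting some of the terms. A matrix sequence with at least one non-scalar term is called reduced if there are no commuting pairs among its terms, i.e. $[A_j,A_k]=A_jA_k-A_kA_j\neq 0$ for all $j<k$. *)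

(* Defs.v *)
From mathcomp Require Import all_boot all_order all_algebra.

Set Implicit Arguments.
Unset Strict Implicit.
Unset Printing Implicit Defensive.

Import GRing.Theory.
Local Open Scope ring_scope.

(* Finite or countably infinite sequences of 2 x 2 matrices; terms are
   indexed from 0, so A_1, A_2, ... are the terms of index 0, 1, ... *)
Inductive mxsequence (R : idomainType) : Type :=
  | FinMxSeq of seq 'M[R]_2
  | InfMxSeq of nat -> 'M[R]_2.

Definition mxterm (R : idomainType) (A : mxsequence R) (i : nat) :
    option 'M[R]_2 :=
  match A with
  | FinMxSeq s => onth s i
  | InfMxSeq a => Some (a i)
  end.

Definition mxlength_geq (R : idomainType) (A : mxsequence R) (n : nat) : bool :=
  match A with
  | FinMxSeq s => (n <= size s)%N
  | InfMxSeq _ => true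
  end.

Definition mxlength_leq (R : idomainType) (A : mxsequence R) (n : nat) : bool :=
  match A with
  | FinMxSeq s => (size s <= n)%N
  | InfMxSeq _ => false
  end.

(* Elements of GL_2(R) are the g \in unitmx: the determinant is a unit of R,
   so that invmx g is the inverse of g with entries in R. *)
Definition mxseq_conj (R : idomainType) (g : 'M[R]_2) (A : mxsequence R) :
    mxsequence R :=
  let c (M : 'M[R]_2) := g *m M *m invmx g in
  match A with
  | FinMxSeq s => FinMxSeq (map c s)
  | InfMxSeq a => InfMxSeq (fun i => c (a i))
  end.

(* The library's is_trig_mx is lower triangularity. *)
Definition upper_triangular (R : idomainType) (M : 'M[R]_2) : Prop :=
  forall i j : 'I_2, (j < i)%N -> M i j = 0.

Definition triangularizable (R : idomainType) (A : mxsequence R) : Prop :=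
  exists2 g : 'M[R]_2, g \in unitmx &
    forall i M, mxterm (mxseq_conj g A) i = Some M -> upper_triangular M.

(* The i-th term of B is the (f i)-th term of A, with f strictly increasing.
   When B is finite, the values of f beyond its length are irrelevant. *)
Definition mxsubsequence (R : idomainType) (B A : mxsequence R) : Prop :=
  exists2 f : nat -> nat, {homo f : i j / (i < j)%N} &
    forall i M, mxterm B i = Some M -> mxterm A (f i) = Some M.

Definition mxcommutator (R : idomainType) (M N : 'M[R]_2) : 'M[R]_2 :=
  M *m N - N *m M.

Definition reduced (R : idomainType) (A : mxsequence R) : Prop :=
  (exists i M, mxterm A i = Some M /\ ~~ is_scalar_mx M) /\
  (forall j k M N, (j < k)%N -> mxterm A j = Some M -> mxterm A k = Some N ->
     mxcommutator M N <> 0).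

(* Main.v *)
Require Import Defs.
From mathcomp Require Import all_boot all_order all_algebra.
From mathcomp Require Import ring.

(** The matrix [g M g^-1] is upper triangular exactly when the bottom row of
    [g] is a left eigenvector of [M].  Two matrices with two independent
    eigenvectors in common commute, so the common eigenline of a noncommuting
    pair is unique; and a matrix with three pairwise independent eigenvectors is
    scalar.  If three pairwise noncommuting matrices, pairwise sharing an
    eigenline, did not share a single one, their lines would be [{a,b}], [{a,c}],
    [{b,c}]; a fourth matrix meeting all three sets contains one of them, hence
    commutes with one of the three matrices.  So with at least four terms all
    eigenlines agree, and the [g] of the first pair works for every term. *)

Set Implicit Arguments.
Unset Strict Implicit.
Unset Printing Implicit Defensive.

Import GRing.Theory.
Local Open Scope ring_scope.

Section Eigenrows.
Variable R : idomainType.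
Implicit Types (u v w : 'rV[R]_2) (M N : 'M[R]_2).

(** * Determinants of pairs of rows, and eigenlines without fractions *)

Definition cross u v : R := u 0 0 * v 0 1 - u 0 1 * v 0 0.

(** Left eigenvector over the fraction field: no eigenvalue is named, as it need not lie in [R]. The
    zero row qualifies too, so [u != 0] is demanded separately where it matters. *)
Definition eigenrow M u := cross (u *m M) u = 0.

Lemma row2P u v : u 0 0 = v 0 0 -> u 0 1 = v 0 1 -> u = v.
Proof.
move=> e0 e1; apply/rowP=> i.
by have /orP[/eqP->|/eqP->] : (i == 0) || (i == 1) by case: i => [[|[|[]]]].
Qed.

Lemma mulmx2E m n (A : 'M[R]_(m, 2)) (B : 'M[R]_(2, n)) i j :
  (A *m B) i j = A i 0 * B 0 j + A i 1 * B 1 j.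
Proof.
rewrite mxE !big_ord_recl big_ord0 addr0.
by have -> : lift ord0 ord0 = 1 :> 'I_2 by apply: val_inj.
Qed.

Lemma crossC u v : cross u v = - cross v u.
Proof. by rewrite /cross; ring. Qed.

Lemma cross_eq0C u v : cross u v = 0 -> cross v u = 0.
Proof. by rewrite crossC => /eqP; rewrite oppr_eq0 => /eqP. Qed.

Lemma crossZl a u v : cross (a *: u) v = a * cross u v.
Proof. by rewrite /cross !mxE; ring. Qed.

Lemma crossZr a u v : cross u (a *: v) = a * cross u v.
Proof. by rewrite /cross !mxE; ring. Qed.

(** Cramer's rule with the denominator [cross u v] cleared. *)
Lemma cross_decomp u v w :
  cross u v *: w = cross w v *: u + cross u w *: v.
Proof. by apply: row2P; rewrite !mxE /cross; ring. Qed.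

Lemma cross_eq0_scale u v : u != 0 -> cross u v = 0 ->
  exists a b, b != 0 /\ b *: v = a *: u.
Proof.
move=> u0 uv.
have e : u 0 0 * v 0 1 = u 0 1 * v 0 0 by apply/eqP; rewrite -subr_eq0; apply/eqP.
have [u00|] := eqVneq (u 0 0) 0; last first.
  by exists (v 0 0), (u 0 0); split=> //; apply: row2P; rewrite !mxE; [ring | rewrite e; ring].
exists (v 0 1), (u 0 1); split.
  by apply: contraNneq u0 => u01; apply/eqP/row2P; rewrite !mxE.
by apply: row2P; rewrite !mxE; [rewrite -e; ring | ring].
Qed.

Lemma eigenrow_parallel M u v :
  u != 0 -> cross u v = 0 -> eigenrow M u -> eigenrow M v.
Proof.
move=> u0 /(cross_eq0_scale u0)[a [b [b0 bv]]] Mu.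
apply: (mulfI b0); apply: (mulfI b0).
by rewrite -crossZr -crossZl scalemxAl bv -scalemxAl crossZl crossZr Mu !mulr0.
Qed.

(** Cramer's rule for [u *m M], whose [v]-component vanishes. When [cross u v != 0], the eigenvalue
    is the fraction [cross (u *m M) v / cross u v]. *)
Lemma eigenrow_scale M u v : eigenrow M u ->
  cross u v *: (u *m M) = cross (u *m M) v *: u.
Proof.
by move=> Mu; rewrite cross_decomp (crossC u) Mu oppr0 scale0r addr0.
Qed.

Lemma scalemx_inj a (u v : 'rV[R]_2) : a != 0 -> a *: u = a *: v -> u = v.
Proof.
by move=> a0 /rowP e; apply/rowP=> j; move: (e j); rewrite !mxE => /(mulfI a0).
Qed.

(** * Commutation from common or numerous eigenlines *)

Lemma cross_mulmx_inj u v M N : cross u v != 0 ->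
  u *m M = u *m N -> v *m M = v *m N -> M = N.
Proof.
move=> uv eu ev; apply/row_matrixP=> i; rewrite !rowE; set w := delta_mx _ _.
apply: (scalemx_inj uv).
by rewrite !scalemxAl cross_decomp !mulmxDl -!scalemxAl eu ev.
Qed.

(** Both products scale [u] by the product of the two eigenvalues; [v] supplies their denominator
    [cross u v], cancelled twice. *)
Lemma eigenrow_comm M N u v : cross u v != 0 ->
  eigenrow M u -> eigenrow N u -> u *m (M *m N) = u *m (N *m M).
Proof.
move=> uv Mu Nu; apply: (scalemx_inj uv); apply: (scalemx_inj uv).
rewrite !mulmxA (scalemxAl _ (u *m M)) eigenrow_scale //.
rewrite (scalemxAl _ (u *m N)) [in RHS]eigenrow_scale //.
rewrite -!scalemxAl !scalerA ![cross u v * _]mulrC -!scalerA.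
by rewrite !eigenrow_scale // !scalerA mulrC.
Qed.

Lemma common_eigenrows_comm M N u v : cross u v != 0 ->
  eigenrow M u -> eigenrow N u -> eigenrow M v -> eigenrow N v ->
  M *m N = N *m M.
Proof.
move=> uv Mu Nu Mv Nv; apply: (cross_mulmx_inj uv).
  exact: eigenrow_comm uv _ _.
by apply: (@eigenrow_comm _ _ _ u) => //; rewrite crossC oppr_eq0.
Qed.

Lemma three_eigenrows_scalar M u v w :
  cross u v != 0 -> cross u w != 0 -> cross v w != 0 ->
  eigenrow M u -> eigenrow M v -> eigenrow M w ->
  cross u v *: M = (cross (u *m M) v)%:M.
Proof.
move=> uv uw vw Mu Mv Mw.
have eu := eigenrow_scale v Mu.
have ev : cross u v *: (v *m M) = cross u (v *m M) *: v.
  by rewrite cross_decomp Mv scale0r add0r.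
(* The eigenvalues on [u] and [v] have these numerators over the same denominator [cross u v]. *)
suff ab : cross u (v *m M) = cross (u *m M) v.
  by apply: (cross_mulmx_inj uv); rewrite -scalemxAr mul_mx_scalar // ev ab.
have e : cross (cross u v *: (cross u v *: w *m M)) (cross u v *: w) = 0.
  by rewrite -scalemxAl !crossZl crossZr Mw !mulr0.
have wv : cross w v != 0 by rewrite crossC oppr_eq0.
move: e; rewrite (cross_decomp u v w) mulmxDl -!scalemxAl scalerDr.
rewrite !scalerA ![cross u v * _]mulrC -!scalerA eu ev.
set al := cross (u *m M) v; set be := cross u (v *m M) => e.
apply/eqP; rewrite -subr_eq0; apply/eqP.
(* With [w] expanded in [u] and [v], condition [e] says that [al - be] times these three nonzero
   factors vanishes. *)
apply: (mulfI uw); apply: (mulfI wv); apply: (mulfI uv).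
rewrite !mulr0 -[RHS]oppr0 -e.
set p := cross w v; set q := cross u w.
by rewrite /cross !mxE; ring.
Qed.

Lemma three_eigenrows_comm M N u v w :
  cross u v != 0 -> cross u w != 0 -> cross v w != 0 ->
  eigenrow M u -> eigenrow M v -> eigenrow M w -> M *m N = N *m M.
Proof.
move=> uv uw vw Mu Mv Mw.
have e := three_eigenrows_scalar uv uw vw Mu Mv Mw.
apply/matrixP=> i j; apply: (mulfI uv).
have /matrixP/(_ i j) : cross u v *: (M *m N) = cross u v *: (N *m M).
  by rewrite scalemxAl scalemxAr e scalar_mxC.
by rewrite !mxE.
Qed.

(** * Shared eigenlines among four matrices *)

Definition share_eigenrow M N :=
  exists u, [/\ u != 0, eigenrow M u & eigenrow N u].

Lemma eigenrow_third (M0 M1 M2 M3 : 'M[R]_2) a :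
  M0 *m M1 <> M1 *m M0 -> M0 *m M3 <> M3 *m M0 ->
  M1 *m M3 <> M3 *m M1 -> M2 *m M3 <> M3 *m M2 ->
  share_eigenrow M0 M2 -> share_eigenrow M0 M3 -> share_eigenrow M1 M2 ->
  share_eigenrow M1 M3 -> share_eigenrow M2 M3 ->
  eigenrow M0 a -> eigenrow M1 a -> eigenrow M2 a.
Proof.
move=> n01 n03 n13 n23 [b [b0 b_0 b_2]] [x [x0 x_0 x_3]] [c [c0 c_1 c_2]].
move=> [y [y0 y_1 y_3]] [z [z0 z_2 z_3]] a_0 a_1.
have [/cross_eq0C ab|ab] := eqVneq (cross a b) 0.
  exact: eigenrow_parallel b0 ab b_2.
have [/cross_eq0C ac|ac] := eqVneq (cross a c) 0.
  exact: eigenrow_parallel c0 ac c_2.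
have [/cross_eq0C bc|bc] := eqVneq (cross b c) 0.
  have b_1 := eigenrow_parallel c0 bc c_1.
  by case: n01; apply: (common_eigenrows_comm ab).
(* Now [a], [b], [c] are pairwise independent, and [M0], [M1], [M2] have the lines [{a,b}], [{a,c}],
   [{b,c}]. If [M3] has [a], its line [z] shared with [M2] leads to a commuting pair, whether [z] is
   [b], [c] or a third line of [M2]. *)
have [/cross_eq0C ax|ax] := eqVneq (cross a x) 0.
  have a_3 := eigenrow_parallel x0 ax x_3.
  have [/cross_eq0C bz|bz] := eqVneq (cross b z) 0.
    have b_3 := eigenrow_parallel z0 bz z_3.
    by case: n03; apply: (common_eigenrows_comm ab).
  have [/cross_eq0C cz|cz] := eqVneq (cross c z) 0.
    have c_3 := eigenrow_parallel z0 cz z_3.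
    by case: n13; apply: (common_eigenrows_comm ac).
  by case: n23; apply: (three_eigenrows_comm _ bc bz cz).
(* Otherwise [x] is parallel to [b], or [M0] has three lines. With [b] in [M3], the line [y] shared
   with [M1] is treated likewise. *)
have [/cross_eq0C bx|bx] := eqVneq (cross b x) 0; last first.
  by case: n03; apply: (three_eigenrows_comm _ ab ax bx).
have b_3 := eigenrow_parallel x0 bx x_3.
have [/cross_eq0C ay|ay] := eqVneq (cross a y) 0.
  have a_3 := eigenrow_parallel y0 ay y_3.
  by case: n03; apply: (common_eigenrows_comm ab).
have [/cross_eq0C cy|cy] := eqVneq (cross c y) 0.
  have c_3 := eigenrow_parallel y0 cy y_3.
  by case: n23; apply: (common_eigenrows_comm bc).
by case: n13; apply: (three_eigenrows_comm _ ac ay cy).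
Qed.

(** * Triangular conjugates in terms of eigenrows *)

Lemma row_unitmx_neq0 (g : 'M[R]_2) i : g \in unitmx -> row i g != 0.
Proof.
move=> gU; apply/eqP=> /(congr1 (mulmx^~ (invmx g))).
rewrite -row_mul mulmxV // mul0mx => /rowP/(_ i).
by rewrite !mxE eqxx => /eqP; rewrite oner_eq0.
Qed.

Lemma upper_triangularE M : upper_triangular M <-> M 1 0 = 0.
Proof.
split=> [h|h i j]; first exact: h.
case: i => [[|[|[]]]] // hi; case: j => [[|[|[]]]] // hj _.
by rewrite -h; congr (M _ _); apply: val_inj.
Qed.

Lemma upper_triangular_conj (g M : 'M[R]_2) : g \in unitmx ->
  upper_triangular (g *m M *m invmx g) <-> eigenrow M (row 1 g).
Proof.
move=> gU; rewrite upper_triangularE /eigenrow.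
set h := invmx g; set u := row 1 g; set w := u *m M.
(* Here [d] is the determinant of the inverse; column 0 of [h] is [d] times the row [u] turned by a
   right angle, so pairing [w] with it gives [d * cross w u]. *)
pose d := h 0 0 * h 1 1 - h 0 1 * h 1 0.
have gh i j : g i 0 * h 0 j + g i 1 * h 1 j = (i == j)%:R.
  by rewrite -mulmx2E mulmxV // mxE.
have h00 : h 0 0 = u 0 1 * d.
  (* The parenthesized sums are the entries 1 and 0 of row 1 of [g *m h]. *)
  have -> : h 0 0 = h 0 0 * (g 1 0 * h 0 1 + g 1 1 * h 1 1)
      - h 0 1 * (g 1 0 * h 0 0 + g 1 1 * h 1 0).
    by rewrite !gh mulr1 mulr0 subr0.
  by rewrite mxE /d; ring.
have h10 : h 1 0 = - (u 0 0 * d).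
  have -> : h 1 0 = h 1 0 * (g 1 0 * h 0 1 + g 1 1 * h 1 1)
      - h 1 1 * (g 1 0 * h 0 0 + g 1 1 * h 1 0).
    by rewrite !gh mulr1 mulr0 subr0.
  by rewrite mxE /d; ring.
have d0 : d != 0.
  apply/eqP=> dE; have /eqP := gh 0 0.
  by rewrite h00 h10 dE !mulr0 oppr0 mulr0 addr0 eq_sym oner_eq0.
have -> : (g *m M *m h) 1 0 = d * cross w u.
  have -> : (g *m M *m h) 1 0 = (w *m h) 0 0 by rewrite /w /u -!row_mul [RHS]mxE.
  by rewrite mulmx2E h00 h10 /cross; ring.
split=> [/eqP|->]; last by rewrite mulr0.
by rewrite mulf_eq0 (negPf d0) => /eqP.
Qed.

Lemma mxterm_conj (g : 'M[R]_2) (A : mxsequence R) i :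
  mxterm (mxseq_conj g A) i = omap (fun M => g *m M *m invmx g) (mxterm A i).
Proof. by case: A => //= s; rewrite onth_map. Qed.

(** The whole [g] is kept: over a domain a common eigenrow need not be a row of an invertible
    matrix. *)
Lemma triangularizableE (A : mxsequence R) : triangularizable A <->
  exists2 g : 'M[R]_2, g \in unitmx &
    forall i M, mxterm A i = Some M -> eigenrow M (row 1 g).
Proof.
split=> -[g gU h]; exists g => // i M.
  move=> e; apply/upper_triangular_conj => //.
  by apply: (h i); rewrite mxterm_conj e.
rewrite mxterm_conj; case e: (mxterm A i) => [N|] //= [<-].
by apply/upper_triangular_conj => //; apply: h e.
Qed.

(** * Terms and subsequences *)

Lemma mxterm_ltn (A : mxsequence R) n i :
  mxlength_geq A n -> (i < n)%N -> exists M, mxterm A i = Some M.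
Proof.
case: A => [s|a] /= hn hi; last by exists (a i).
have := onthTE s i; rewrite (leq_trans hi hn).
by case: (onth s i) => // M _; exists M.
Qed.

Lemma triangularizable_sub (A B : mxsequence R) :
  mxsubsequence B A -> triangularizable A -> triangularizable B.
Proof.
move=> [f _ hf] /triangularizableE[g gU hg]; apply/triangularizableE.
by exists g => // i M /hf/hg.
Qed.

Lemma mxsubsequence_pair (A : mxsequence R) j k M N : (j < k)%N ->
  mxterm A j = Some M -> mxterm A k = Some N ->
  mxsubsequence (FinMxSeq [:: M; N]) A.
Proof.
(* Index 0 goes to [j] and 1 to [k]; the values after [k] merely continue the strict increase. *)
move=> jk hj hk; exists (fun i => if i is i'.+1 then (k + i')%N else j).
  case=> [|a] [|b] //= ab; last by rewrite ltn_add2l.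
  exact: leq_trans jk (leq_addr _ _).
by case=> [|[|i]] P //=; rewrite ?addn0 ?hj ?hk // onth0n.
Qed.

End Eigenrows.

Theorem theorem1p12 (R : idomainType) (A : mxsequence R)
    (hred : reduced A) (hlen : mxlength_geq A 4) :
  triangularizable A <->
  (forall B : mxsequence R,
     mxsubsequence B A -> mxlength_leq B 2 -> triangularizable B).
Proof.
split=> [hA B hB _|hA]; first exact: triangularizable_sub hB hA.
have pairT j k M N : (j < k)%N -> mxterm A j = Some M -> mxterm A k = Some N ->
    exists2 g : 'M[R]_2, g \in unitmx &
      eigenrow M (row 1 g) /\ eigenrow N (row 1 g).
  move=> jk hj hk.
  have /triangularizableE[g gU hg] := hA _ (mxsubsequence_pair jk hj hk) isT.
  by exists g => //; split; [apply: (hg 0%N) | apply: (hg 1%N)].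
have share j k M N : j <> k -> mxterm A j = Some M -> mxterm A k = Some N ->
    share_eigenrow M N.
  move=> jk hj hk; case: (ltngtP j k) => // [lt|gt].
    have [g gU [gM gN]] := pairT _ _ _ _ lt hj hk.
    by exists (row 1 g); rewrite row_unitmx_neq0.
  have [g gU [gN gM]] := pairT _ _ _ _ gt hk hj.
  by exists (row 1 g); rewrite row_unitmx_neq0.
have nc j k M N : j <> k -> mxterm A j = Some M -> mxterm A k = Some N ->
    M *m N <> N *m M.
  move=> jk hj hk e; case: hred => _ hc; case: (ltngtP j k) => // [lt|gt].
    by apply: (hc _ _ _ _ lt hj hk); rewrite /mxcommutator e subrr.
  by apply: (hc _ _ _ _ gt hk hj); rewrite /mxcommutator e subrr.
have [M0 h0] := mxterm_ltn hlen (isT : 0 < 4)%N.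
have [M1 h1] := mxterm_ltn hlen (isT : 1 < 4)%N.
(* This [g] will serve for all terms: its row 1 spans the common eigenline of the first two. *)
have [g gU [g0 g1]] := pairT 0%N 1%N _ _ isT h0 h1.
apply/triangularizableE; exists g => // -[|[|i]] M hM.
- by move: hM; rewrite h0 => -[<-].
- by move: hM; rewrite h1 => -[<-].
(* A fourth term apart from indices 0, 1 and [i.+2] exists because the length is at least 4: index 3
   if [i] is 0, index 2 otherwise. *)
have [k [k4 k0 k1 ki]] : exists k, [/\ (k < 4)%N, 0%N <> k, 1%N <> k & i.+2 <> k].
  by case: i {hM} => [|i]; [exists 3%N | exists 2%N].
have [M3 h3] := mxterm_ltn hlen k4.
apply: (@eigenrow_third _ M0 M1 M M3) => //.
- exact: nc h0 h1.
- exact: nc k0 h0 h3.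
- exact: nc k1 h1 h3.
- exact: nc ki hM h3.
- exact: share h0 hM.
- exact: share k0 h0 h3.
- exact: share h1 hM.
- exact: share k1 h1 h3.
- exact: share ki hM h3.
Qed.
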